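(* The fractions of nodes of rank $k$ and at layer $k$ in random recursive trees are asymptotically self-averaging: for every fixed integer $k\ge 0$, $$\mathrm{Var}\left[\frac{R_{n,k}}{n}\right]\lesssim\frac1n,\qquad \mathrm{Var}\left[\frac{L_{n,k}}{n}\right]\lesssim\frac1n,$$ that is, there exists a constant $C$ (which may depend on $k$) such that $\mathrm{Var}[R_{n,k}/n]\le C/n$ and $\mathrm{Var}[L_{n,k}/n]\le C/n$ for all $n\geq 1$.
   Context: A random recursive tree (RRT) $G_n$ of size $n$ is a random labeled tree on the node set $\{1,\dots,n\}$ built as follows: start with node $1$; for $t=2,\dots,n$, node $t$ is attached by an edge to one node chosen uniformly at random from the existing nodes $\{1,\dots,t-1\}$, independently of previous choices. A leaf is a node of degree $1$ (the root, node $1$, is also a leaf if it has degree $1$). The rank of a node is its graph distance to the closest leaf, so leaves have rank $0$; in the one-node tree the single node has rank $0$. The layer of a node is the number of times all current leaves must be simultaneously stripped off (removed) from the tree for the node to become a leaf; leaves of the original tree are at layer $0$, and if after some number of rounds the remaining tree consists of a single isolated node, that node counts as a leaf at that stage. $R_{n,k}$ and $L_{n,k}$ denote the numbers of nodes of rank $k$ and at layer $k$, respectively, in $G_n$. *)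

(* Defs.v *)
From HB Require Import structures.
From mathcomp Require Import all_boot all_order all_algebra finmap.
From mathcomp Require Import all_classical all_reals all_analysis.

Set Implicit Arguments.
Unset Strict Implicit.
Unset Printing Implicit Defensive.

Section Graph.

Variables (T : finType) (e : rel T).

(* Degree of [v] in the subgraph induced by [S]. *)
Definition degree_in (S : {set T}) (v : T) : nat := #|[set u in S | e v u]|.

(* The second disjunct is the convention that the only node of a one-node tree
   is a leaf, although it has degree 0. *)
Definition leaves (S : {set T}) : {set T} :=
  [set v in S | (degree_in S v == 1) || (S == [set v])].

Definition walk (m : nat) (u v : T) : bool :=
  [exists p : m.-tuple T, path e u p && (last u p == v)].

(* Length of a shortest walk from [u] to [v]; a shortest walk has fewer than
   [#|T|] edges, so the value [#|T|] means that there is none. *)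
Definition gdist (u v : T) : nat :=
  \big[minn/#|T|]_(m < #|T| | walk m u v) m.

Definition rank (v : T) : nat :=
  \big[minn/#|T|]_(l in leaves [set: T]) gdist v l.

Definition strip (S : {set T}) : {set T} := S :\: leaves S.

(* A node is a leaf in at most one round, since it is then stripped off; so [k]
   is the number of rounds needed for [v] to become a leaf. *)
Definition at_layer (k : nat) (v : T) : bool :=
  v \in leaves (iter k strip [set: T]).

Definition num_rank (k : nat) : nat := #|[set v | rank v == k]|.

Definition num_layer (k : nat) : nat := #|[set v | at_layer k v]|.

End Graph.

(* The nodes 1, ..., n are represented by 0, ..., n - 1, so that the root is 0
   and the node [i > 0] is attached to the node [p i], which must be one of
   0, ..., i - 1. The value [p 0] is irrelevant. *)
Definition recursive_tree (n : nat) (p : nat -> nat) : rel 'I_n :=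
  [rel i j : 'I_n | (i < j) && (p j == i) || (j < i) && (p i == j)].
Arguments recursive_tree : clear implicits.

Section RandomRecursiveTree.

Local Open Scope classical_set_scope.
Local Open Scope ereal_scope.

Context (d : measure_display) (T : measurableType d) (R : realType)
  (P : probability T R).

Definition mutually_independent (A : set nat) (X : nat -> {RV P >-> nat}) :
    Prop :=
  forall (J : {fset nat}) (B : nat -> set nat),
    [set` J] `<=` A -> (forall i, measurable (B i)) ->
    P (\bigcap_(i in [set` J]) (X i @^-1` B i)) =
    \prod_(i <- J) P (X i @^-1` B i).

Definition uniform_attachment (n : nat) (par : nat -> {RV P >-> nat}) : Prop :=
  (forall i j : nat, (i < n)%N -> (j < i)%N ->
     P (par i @^-1` [set j]) = (i%:R^-1)%R%:E) /\
  mutually_independent [set i | (0 < i < n)%N] par.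

End RandomRecursiveTree.

(* Main.v *)
Require Import Defs.
From mathcomp Require Import all_boot all_order all_algebra.
From mathcomp Require Import ring lra zify.
From mathcomp Require boolp.

(** The number [f] of nodes of rank [k] (or at layer [k]) is a function of the
independent parents [q 1, ..., q N] of the nodes of a tree of size [N + 1], and
its variance is bounded with the Efron-Stein inequality ([efron_stein])

  Var f <= sum_i E (f - f_i)^2,

where [f_i] does not depend on [q i].  The choice made for [f_i] is the value of
the statistic on the forest obtained by cutting the edge from [i] to its parent.

Rank and layer are local: whether a node has rank [k], or is at layer [k], is
read off its neighbourhood of radius [k + 1], up to bounded corrections due to
the degenerate cases ([num_rank_local], [num_layer_local]).  Cutting the edge
only alters adjacencies of [i] and of a neighbour of [i], so [|f - f_i|] is at
most a constant times the size of the ball of radius [k + 2] around [i]; the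
ball is taken in the tree itself, so [q i] needs no resampling.

What remains is that the sum over [i] of the squared sizes of these balls has
expectation [O(N)].  In any graph, sums of powers of ball sizes are bounded by
sums of powers of degrees ([ball_moment_le]).  In the random tree all degree
moments are linear in [N], because they are dominated by the exponential moment
[sum_v (3/2)^(children of v)], whose expectation [z_n] satisfies the recursion
[z_(n+1) = (1 + 1/(2n)) z_n + 1] and hence [z_n <= 2n] ([avg_exp_children]).

All this is done with an expectation [avg] defined by iterated finite averages.
The identity [integral_avg] transfers the result to an arbitrary probability
space carrying independent uniform parents. *)

Set Implicit Arguments.
Unset Strict Implicit.
Unset Printing Implicit Defensive.

Import Order.TTheory GRing.Theory Num.Theory.

(** * Averages over the choices of parents, and the Efron-Stein inequality *)

Section Mean.
Local Open Scope ring_scope.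
Context {R : realFieldType}.
Definition mean m (x : nat -> R) : R := m.+1%:R^-1 * \sum_(j < m.+1) x j.

Lemma mean_const m c : mean m (fun=> c) = c.
Proof.
by rewrite /mean sumr_const card_ord -[c *+ _]mulr_natl mulKf ?pnatr_eq0.
Qed.

Lemma meanD m x y : mean m (fun j => x j + y j) = mean m x + mean m y.
Proof. by rewrite /mean big_split mulrDr. Qed.

Lemma meanZ m a x : mean m (fun j => a * x j) = a * mean m x.
Proof. by rewrite /mean -mulr_sumr mulrCA. Qed.

Lemma ler_mean m x y : (forall j, x j <= y j) -> mean m x <= mean m y.
Proof. by move=> xy; rewrite /mean ler_pM2l ?invr_gt0 ?ltr0n ?ler_sum. Qed.

Lemma eq_mean m x y : x =1 y -> mean m x = mean m y.
Proof. by move=> xy; congr (_ * _); apply: eq_bigr => j _; apply: xy. Qed.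

(** Decomposition of a mean squared distance into variance and squared bias; the
two inequalities after it drop one of the two terms. *)
Lemma mean_sqr_dist m x c :
  mean m (fun j => (x j - c) ^+ 2) =
  mean m (fun j => (x j - mean m x) ^+ 2) + (mean m x - c) ^+ 2.
Proof.
set a := mean m x.
rewrite (@eq_mean m (fun j => (x j - c) ^+ 2) (fun j =>
  (x j - a) ^+ 2 + (2 * (a - c) * x j + (a - c) * - (a + c)))); last first.
  by move=> j; ring.
rewrite !(meanD, meanZ, mean_const) -/a; ring.
Qed.

Lemma mean_sqr_ge0 m x : 0 <= mean m (fun j => x j ^+ 2).
Proof. by rewrite -[leLHS](mean_const m); apply: ler_mean => j; apply: sqr_ge0. Qed.

Lemma mean_sqr_le m x : mean m x ^+ 2 <= mean m (fun j => x j ^+ 2).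
Proof.
have := mean_sqr_dist m x 0; rewrite subr0.
rewrite (@eq_mean m _ (fun j => x j ^+ 2)) => [->|j]; last by rewrite subr0.
by rewrite lerDr mean_sqr_ge0.
Qed.

Lemma mean_sqr_dist_min m x c :
  mean m (fun j => (x j - mean m x) ^+ 2) <= mean m (fun j => (x j - c) ^+ 2).
Proof. by rewrite (mean_sqr_dist m x c) lerDl sqr_ge0. Qed.
End Mean.

Section Average.
Local Open Scope ring_scope.
Context {R : realFieldType}.
Implicit Types (q : nat -> nat) (g : (nat -> nat) -> R).

(** Node [i] gets the parent [j].  Taking [j = i] leaves [i] without a parent,
since in [recursive_tree] only a smaller node can be a parent. *)
Definition attach q i j : nat -> nat := [eta q with i |-> j].

Definition attach_mean m g : (nat -> nat) -> R :=
  fun q => mean m (fun j => g (attach q m.+1 j)).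

(** The expectation of [g] when the parents of the nodes [1, ..., N] are
independent and the parent of [i] is uniform on [0, ..., i - 1].  The value
[0] given to all other nodes is arbitrary. *)
Fixpoint avg N g : R :=
  if N is m.+1 then avg m (attach_mean m g) else g (fun=> 0%N).

Lemma ler_avg N g h : (forall q, g q <= h q) -> avg N g <= avg N h.
Proof.
by elim: N g h => /= [|N IH] g h gh //; apply: IH => q; apply: ler_mean.
Qed.

Lemma eq_avg N g h : g =1 h -> avg N g = avg N h.
Proof.
by move=> gh; apply/eqP; rewrite eq_le !ler_avg// => q; rewrite gh.
Qed.

Lemma avg_const N c : avg N (fun=> c) = c.
Proof.
elim: N => //= N IH; rewrite -[RHS]IH; apply: eq_avg => q.
exact: mean_const.
Qed.

Lemma avgD N g h : avg N (fun q => g q + h q) = avg N g + avg N h.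
Proof.
elim: N g h => //= N IH g h; rewrite -IH; apply: eq_avg => q.
exact: meanD.
Qed.

Lemma avgZ N a g : avg N (fun q => a * g q) = a * avg N g.
Proof.
elim: N g => //= N IH g; rewrite -IH; apply: eq_avg => q.
exact: meanZ.
Qed.

Lemma avg_sum N (I : Type) (r : seq I) (g : I -> (nat -> nat) -> R) :
  avg N (fun q => \sum_(i <- r) g i q) = \sum_(i <- r) avg N (g i).
Proof.
elim: r => [|i r IH].
  by rewrite big_nil -[RHS](avg_const N); apply: eq_avg => q; rewrite big_nil.
by rewrite big_cons -IH -avgD; apply: eq_avg => q; rewrite big_cons.
Qed.

(** Induction on the number of coordinates.  Averaging over the last coordinate
splits the variance of [g] into the mean of the conditional variance, which is
at most the last summand because a variance is the least mean squared distance
to a constant, and the variance of the conditional mean, to which the induction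
hypothesis applies; the averages of the [g_ i] only bring the conditional mean
closer to them, by convexity of the square. *)
Lemma efron_stein N g (g_ : nat -> (nat -> nat) -> R) :
    (forall i q q', (forall x, x != i -> q x = q' x) -> g_ i q = g_ i q') ->
  avg N (fun q => (g q - avg N g) ^+ 2) <=
  \sum_(1 <= i < N.+1) avg N (fun q => (g q - g_ i q) ^+ 2).
Proof.
elim: N g g_ => [|N IH] g g_ g_i /=; first by rewrite subrr expr0n big_geq.
set c := avg N (attach_mean N g).
have -> : avg N (attach_mean N (fun q => (g q - c) ^+ 2)) =
    avg N (fun q => attach_mean N (fun q' => (g q' - attach_mean N g q) ^+ 2) q) +
    avg N (fun q => (attach_mean N g q - c) ^+ 2).
  rewrite -avgD; apply: eq_avg => q.
  by rewrite /attach_mean mean_sqr_dist.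
rewrite big_nat_recr //= [leLHS]addrC lerD//.
  have /(IH (attach_mean N g) (fun i => attach_mean N (g_ i)))/le_trans :
    forall i q q',
      (forall x, x != i -> q x = q' x) ->
      attach_mean N (g_ i) q = attach_mean N (g_ i) q'.
    move=> i q q' qq'; apply: eq_mean => j; apply: g_i => x xi.
    by rewrite /attach/=; case: ifP => // _; apply: qq'.
  apply; apply: ler_sum => i _; apply: ler_avg => q.
  rewrite /attach_mean; apply: le_trans (mean_sqr_le _ _).
  rewrite (@eq_mean _ _ (fun j => g (attach q N.+1 j) - _) (fun j =>
    g (attach q N.+1 j) + -1 * g_ i (attach q N.+1 j))) => [|j]; last first.
    by rewrite mulN1r.
  by rewrite meanD meanZ mulN1r.
apply: ler_avg => q; apply: le_trans (mean_sqr_dist_min _ _ (g_ N.+1 q)) _.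
apply: ler_mean => j; rewrite (g_i _ (attach q N.+1 j) q) // => x xN.
by rewrite /attach/= (negPf xN).
Qed.

End Average.

(** * Exponential degree moments of the random tree *)

Section DegreeMoments.
Local Open Scope ring_scope.
Context {R : realFieldType}.

(** The condition [v < i] makes this count the edges of the tree also when [q] is
not a valid choice of parents; in particular a new node starts childless
whatever [q] is. *)
Definition children q n v : nat := \sum_(1 <= i < n) ((q i == v) && (v < i)%N).

Lemma children_attach q n j v :
  children (attach q n.+1 j) n.+2 v =
  (children q n.+1 v + ((j == v) && (v < n.+1)))%N.
Proof.
rewrite /children big_nat_recr//= /attach/= eqxx; congr addn.
apply: eq_big_nat => i /andP[_ iN]; by rewrite (ltn_eqF iN).
Qed.

Lemma children_last q n : children q n.+1 n = 0%N.
Proof.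
rewrite /children big_nat big1// => i /andP[_ i_le].
by rewrite [(n < i)%N]ltnNge -ltnS i_le andbF.
Qed.

(** The base must lie in the interval from 1 to 2, so that the expected growth rate
in [mean_exp_children] stays below [1 / n] and the moment remains linear. *)
Definition exp_children n q : R := \sum_(v < n) (3 / 2) ^+ children q n v.

(** A uniform node multiplies its weight by [3 / 2], which adds half of the mean
weight on average; the new node has weight 1. *)
Lemma mean_exp_children N q :
  attach_mean N (exp_children N.+2) q =
  (1 + 2^-1 * N.+1%:R^-1) * exp_children N.+1 q + 1.
Proof.
pose x v := (3 / 2 : R) ^+ children q N.+1 v.
rewrite /attach_mean (@eq_mean _ _ _ (fun j =>
    (exp_children N.+1 q + 1) + 2^-1 * \sum_(v < N.+1 | j == v) x v)) => [|j].
  rewrite meanD mean_const meanZ /mean (exchange_big_dep predT)//=.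
  rewrite (eq_bigr (fun v : 'I_N.+1 => x v)) => [|v _].
    rewrite -/(exp_children N.+1 q); ring.
  by rewrite (big_pred1 v)// => i; rewrite val_eqE.
rewrite /exp_children big_ord_recr/= children_last expr0.
rewrite [RHS]addrAC; congr (_ + 1).
rewrite [X in _ + _ * X]big_mkcond mulr_sumr -big_split/=.
apply: eq_bigr => v _; rewrite children_attach ltn_ord andbT exprD -/(x v).
by case: (j == v); rewrite ?expr1 ?expr0; field.
Qed.

Lemma avg_exp_children N : avg N (exp_children N.+1) <= 2 * N.+1%:R.
Proof.
elim: N => [|N IH].
  rewrite /= /exp_children big_ord1 /children big_geq// expr0 mulr1.
  lra.
have -> : avg N.+1 (exp_children N.+2) =
    (1 + 2^-1 * N.+1%:R^-1) * avg N (exp_children N.+1) + 1.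
  rewrite -[X in _ + X](avg_const N) -avgZ -avgD /=.
  by apply: eq_avg => q; rewrite mean_exp_children.
have N0 : 0 < N.+1%:R :> R by rewrite ltr0n.
have : (1 + 2^-1 * N.+1%:R^-1) * avg N (exp_children N.+1) <=
       (1 + 2^-1 * N.+1%:R^-1) * (2 * N.+1%:R) :> R.
  by rewrite ler_pM2l// addr_gt0// mulr_gt0 ?invr_gt0.
have -> : (1 + 2^-1 * N.+1%:R^-1) * (2 * N.+1%:R) = 2 * N.+1%:R + 1 :> R.
  by field; rewrite nat1r pnatr_eq0.
have -> : N.+2%:R = N.+1%:R + 1 :> R by rewrite natr1.
move=> H; rewrite mulrDr mulr1 -[X in _ <= _ + X]natr1 addrA lerD2r; exact: H.
Qed.

Lemma bernoulli_inequality (x : R) n : 0 <= x -> 1 + x * n%:R <= (1 + x) ^+ n.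
Proof.
move=> x0; elim: n => [|n IH]; first by rewrite mulr0 addr0.
rewrite exprS; apply: le_trans (ler_wpM2l _ IH); last by rewrite addr_ge0.
rewrite -natr1 -subr_ge0 [leRHS](_ : _ = x ^+ 2 * n%:R); last by ring.
by rewrite mulr_ge0 ?exprn_ge0.
Qed.

(** The induction on [q] lowers the base to [1 + a] with [a = (z - 1) / 3 <= 1], for
which [(1 + a)^2 <= 1 + 3 a = z]: one factor [(1 + a)^n] absorbs [n^q], and the
other absorbs [n] by Bernoulli's inequality. *)
Lemma expn_le_exp (z : R) q : 1 < z <= 2 ->
  exists2 C : R, 0 < C & forall n, (n ^ q)%:R <= C * z ^+ n.
Proof.
elim: q z => [|q IH] z /andP[z1 z2].
  by exists 1 => // n; rewrite expn0 mul1r exprn_ege1// ltW.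
pose a := (z - 1) / 3.
have a0 : 0 < a by rewrite divr_gt0// subr_gt0.
have [|C C0 HC] := IH (1 + a); first by rewrite /a; apply/andP; split; lra.
exists (C * a^-1) => [|n]; first by rewrite mulr_gt0// invr_gt0.
have n_le : n%:R <= a^-1 * (1 + a) ^+ n.
  rewrite -ler_pdivrMl ?invr_gt0// invrK.
  by apply: le_trans (bernoulli_inequality _ (ltW a0)); rewrite lerDr.
have sq_le : (1 + a) ^+ n * (1 + a) ^+ n <= z ^+ n.
  by rewrite -exprMn lerXn2r// ?nnegrE ?mulr_ge0 ?addr_ge0 ?ltW// /a; nra.
rewrite expnSr natrM; apply: le_trans (ler_pM _ _ (HC n) n_le) _ => //.
by rewrite mulrACA ler_wpM2l// ltW// mulr_gt0// invr_gt0.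
Qed.

End DegreeMoments.

(** * Balls in finite graphs *)

Section Ball.
Context {T : finType} (e : rel T).
Implicit Types (S : {set T}) (v : T).

Definition nbhd S := [set v | (v \in S) || [exists u in S, e v u]].

Lemma nbhd_sub S : S \subset nbhd S.
Proof. by apply/subsetP => v vS; rewrite inE vS. Qed.

Lemma nbhdS S1 S2 : S1 \subset S2 -> nbhd S1 \subset nbhd S2.
Proof.
move=> /subsetP S12; apply/subsetP => v; rewrite !inE.
case/orP => [/S12 -> //|/existsP[u /andP[/S12 uS evu]]].
by apply/orP; right; apply/existsP; exists u; rewrite uS.
Qed.

Definition thicken k S := iter k nbhd S.

Lemma thicken_sub k S : S \subset thicken k S.
Proof. by elim: k => //= k IH; apply: subset_trans IH (nbhd_sub _). Qed.

Lemma mem_nbhd_cup S v : v \in nbhd S -> exists2 u, u \in S & v \in nbhd [set u].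
Proof.
rewrite inE => /orP[vS|/existsP[u /andP[uS evu]]].
  by exists v => //; rewrite !inE eqxx.
by exists u => //; rewrite !inE; apply/orP; right; apply/existsP; exists u;
  rewrite inE eqxx.
Qed.

Lemma mem_thicken_cup k S v : v \in thicken k S ->
  exists2 u, u \in S & v \in thicken k [set u].
Proof.
elim: k v => [|k IH] v /=; first by exists v; rewrite ?inE.
move=> /mem_nbhd_cup[w /IH[u uS wu] vw]; exists u => //.
by apply: (subsetP (nbhdS _)) vw; rewrite sub1set.
Qed.

Definition ball k v := thicken k [set v].

Lemma card_ball_succ k v :
  #|ball k.+1 v| <= \sum_(u in nbhd [set v]) #|ball k u|.
Proof.
rewrite -sum1_card.
pose F u := \sum_(w in ball k u) 1.
rewrite [leqRHS](eq_bigr F) => [|u _]; last by rewrite /F sum1_card.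
rewrite (exchange_big_dep predT) //= [leqLHS]big_mkcond leq_sum // => w _.
case: ifP => // wb.
have /mem_thicken_cup[u uN wu] : w \in thicken k (nbhd [set v]).
  by rewrite /thicken -iterSr.
by rewrite (bigD1 u) //= uN.
Qed.

Definition nbhd_size v := #|nbhd [set v]|.

Lemma nbhd_size_gt0 v : 0 < nbhd_size v.
Proof. by apply/card_gt0P; exists v; rewrite !inE eqxx. Qed.

Hypothesis e_sym : symmetric e.

Lemma nbhd1_sym u v : (u \in nbhd [set v]) = (v \in nbhd [set u]).
Proof.
rewrite !inE eq_sym; congr orb; apply/existsP/existsP => -[w];
  rewrite inE => /andP[/eqP-> ?].
  by exists u; rewrite inE eqxx e_sym.
by exists v; rewrite inE eqxx e_sym.
Qed.

(** A sum of [nbhd_size v] terms is at most [nbhd_size v] times the largest one, so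
its [p]-th power is at most [nbhd_size v ^ p] times that of the largest one. *)
Lemma card_ball_succ_exp k p v : (#|ball k.+1 v| ^ p <=
  nbhd_size v ^ p * \sum_(u in nbhd [set v]) #|ball k u| ^ p).
Proof.
case: (@eq_bigmax_cond _ (mem (nbhd [set v])) (fun u => #|ball k u|)).
  exact: nbhd_size_gt0.
move=> u uv umax; rewrite (bigD1 u)//= mulnDr.
apply: leq_trans (leq_addr _ _); rewrite -expnMn.
case: p => // p; rewrite leq_exp2r//.
apply: leq_trans (card_ball_succ _ _) _.
rewrite -sum_nat_const; apply: leq_sum => w wv.
by rewrite -umax; apply: leq_bigmax_cond.
Qed.

End Ball.

(** Induction on the radius, for all exponents at once.  A product of a degree power
and a ball power over an edge is split by [x * y <= x ^ 2 + y ^ 2]; summing over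
the edges turns each square into a sum over the nodes, with one more factor
degree, and the same splitting is applied once more to the ball term. *)
Lemma ball_moment_le k p : exists C q, forall (T : finType) (e : rel T),
  symmetric e ->
  \sum_v #|ball e k v| ^ p <= C * \sum_v nbhd_size e v ^ q.
Proof.
elim: k p => [|k IH] p.
  exists 1, 0 => T e _; rewrite mul1n leq_sum// => v _.
  by rewrite /ball /thicken/= cards1 exp1n.
have [C [q HC]] := IH (4 * p); exists C.+2, (2 * p + q + 2) => T e e_sym.
set D := nbhd_size e; pose B v := #|ball e k v|.
have D1 v : 0 < D v by apply: nbhd_size_gt0.
have AM x y : x * y <= x ^ 2 + y ^ 2.
  rewrite -!mulnn; case: (leqP x y) => [xy|/ltnW yx].
    by apply: leq_trans (leq_addl _ _); rewrite leq_mul2r xy orbT.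
  by apply: leq_trans (leq_addr _ _); rewrite leq_mul2l yx orbT.
have step1 : \sum_v #|ball e k.+1 v| ^ p <=
    \sum_v \sum_(u in nbhd e [set v]) (D v ^ (2 * p) + B u ^ (2 * p)).
  apply: leq_sum => v _; apply: leq_trans (card_ball_succ_exp _ _ _ _) _.
  rewrite big_distrr; apply: leq_sum => u _ /=.
  rewrite ![2 * p]mulnC !expnM; exact: AM.
apply: leq_trans step1 _.
under eq_bigr do rewrite big_split sum_nat_const /=.
rewrite big_split/= (exchange_big_dep predT)//=.
have step2 u : \sum_(v | u \in nbhd e [set v]) B u ^ (2 * p) <=
    D u ^ 2 + B u ^ (4 * p).
  under eq_bigl do rewrite (nbhd1_sym e_sym).
  rewrite sum_nat_const -/(D u).
  have -> : 4 * p = 2 * p * 2 by lia.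
  rewrite [in leqRHS]expnM; exact: AM.
have mono q1 : q1 <= 2 * p + q + 2 ->
    \sum_v D v ^ q1 <= \sum_v D v ^ (2 * p + q + 2).
  by move=> ?; apply: leq_sum => v _; rewrite leq_pexp2l.
have := mono (2 * p).+1 ltac:(lia); have := mono 2 ltac:(lia).
have : \sum_v B v ^ (4 * p) <= C * \sum_v D v ^ (2 * p + q + 2).
  by apply: leq_trans (HC T e e_sym) _; rewrite leq_mul2l mono ?orbT//; lia.
have : \sum_u \sum_(v | u \in nbhd e [set v]) B u ^ (2 * p) <=
       \sum_u D u ^ 2 + \sum_u B u ^ (4 * p).
  by rewrite -big_split leq_sum.
have -> : \sum_v #|nbhd e [set v]| * D v ^ (2 * p) = \sum_v D v ^ (2 * p).+1.
  by apply: eq_bigr => v _; rewrite expnS.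
lia.
Qed.

(** * Rank and layer are local *)

Section Walk.
Context {T : finType} (e : rel T).

Lemma walk0 u v : walk e 0 u v = (u == v).
Proof.
apply/existsP/idP => [[p]|uv]; first by rewrite tuple0.
by exists [tuple].
Qed.

Lemma walkS m u v : walk e m.+1 u v = [exists w, e u w && walk e m w v].
Proof.
apply/existsP/existsP => [[p]|[w /andP[euw /existsP[p /andP[pw pv]]]]].
  case/tupleP: p => w p /= /andP[/andP[euw pw] pv].
  by exists w; rewrite euw; apply/existsP; exists p; rewrite pw.
by exists [tuple of w :: p]; rewrite /= euw pw.
Qed.

Lemma thickenP k (S : {set T}) v :
  reflect (exists2 m, m <= k & exists2 l, l \in S & walk e m v l)
          (v \in thicken e k S).
Proof.
apply: (iffP idP) => [|[m mk [l lS]]].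
  elim: k v => [|k IH] v /=.
    by move=> vS; exists 0 => //; exists v => //; rewrite walk0.
  rewrite inE => /orP[/IH[m mk ?]|/existsP[u /andP[/IH[m mk [l lS wl]] evu]]].
    by exists m => //; apply: leqW.
  exists m.+1 => //; exists l => //.
  by rewrite walkS; apply/existsP; exists u; rewrite evu.
elim: m k mk v => [|m IH] k mk v.
  by rewrite walk0 => /eqP->; apply: (subsetP (thicken_sub _ _ _)).
case: k mk => // k mk; rewrite walkS => /existsP[w /andP[evw /IH]] /(_ k mk) wk.
by rewrite /= inE; apply/orP; right; apply/existsP; exists w; rewrite wk.
Qed.

Lemma bigmin_leP (I : finType) (P : pred I) (F : I -> nat) d k : k < d ->
  reflect (exists2 i, P i & F i <= k) (\big[minn/d]_(i | P i) F i <= k).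
Proof.
move=> kd; apply: (iffP idP) => [|[i Pi Fi]].
  elim/big_ind: _ => [|x y IHx IHy|i Pi Fi]; last by exists i.
    by rewrite leqNgt kd.
  by rewrite geq_min => /orP[/IHx|/IHy].
have : i \in index_enum I by rewrite mem_index_enum.
elim: (index_enum I) => // j r IH; rewrite inE big_cons => /orP[/eqP<-|/IH le].
  by rewrite Pi geq_min Fi.
by case: ifP => // _; rewrite geq_min le orbT.
Qed.

Lemma rank_leP k v : k < #|T| ->
  (rank e v <= k) = (v \in thicken e k (leaves e [set: T])).
Proof.
move=> kT; apply/(bigmin_leP _ _ kT)/thickenP.
  move=> [l lL /(bigmin_leP _ _ kT)[m wm mk]].
  by exists m => //; exists l.
move=> [m mk [l lL wl]]; exists l => //.
apply/(bigmin_leP _ _ kT); by exists (Ordinal (leq_ltn_trans mk kT)).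
Qed.

End Walk.

(** [e] and [e'] have the same adjacencies at every node outside [D]. *)
Definition agree_off (T : finType) (e e' : rel T) (D : {set T}) :=
  forall v u, v \notin D -> e v u = e' v u.

Section LocalSets.
Context {T : finType}.
Implicit Types (e : rel T) (D S : {set T}) (v : T).

Lemma notin_nbhd e S v : v \notin nbhd e S ->
  v \notin S /\ forall u, e v u -> u \notin S.
Proof.
rewrite inE negb_or => /andP[-> /existsPn H]; split=> // u evu.
by have := H u; rewrite evu andbT.
Qed.

(** [X] and [X'] are to be the same construction performed with [e] and with [e'],
whose adjacencies differ only in [D]; it then has radius [k]. *)
Definition local_at e e' D k (X X' : {set T}) :=
  forall v, v \notin thicken e k D -> (v \in X) = (v \in X').

Context {e e' : rel T} {D : {set T}} (agr : agree_off e e' D).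

Lemma local_atW k k' X X' : k <= k' ->
  local_at e e' D k X X' -> local_at e e' D k' X X'.
Proof.
move=> /subnK<- loc v vD; apply: loc; apply: contraNN vD.
by rewrite /thicken iterD; apply: subsetP; apply: thicken_sub.
Qed.

Lemma local_atD k X X' Y Y' : local_at e e' D k X X' ->
  local_at e e' D k Y Y' -> local_at e e' D k (X :\: Y) (X' :\: Y').
Proof. by move=> lX lY v vD; rewrite !inE lX ?lY. Qed.

Lemma notin_thickenS k v : v \notin thicken e k.+1 D ->
  v \notin thicken e k D /\ (forall u, e v u = e' v u) /\
  forall u, e v u -> u \notin thicken e k D.
Proof.
move=> /notin_nbhd[vD nD]; do 2!split=> //.
by move=> u; apply: agr; apply: contraNN vD; apply: subsetP; apply: thicken_sub.
Qed.

Lemma local_at_nbhd k X X' : local_at e e' D k X X' ->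
  local_at e e' D k.+1 (nbhd e X) (nbhd e' X').
Proof.
move=> loc v /notin_thickenS[vD [rows nbr]].
rewrite !inE loc//; congr orb; apply: eq_existsb => u.
by rewrite -rows; case: (boolP (e v u)) => [/nbr/loc->|]; rewrite ?andbT ?andbF.
Qed.

Lemma local_at_thicken j k X X' : local_at e e' D k X X' ->
  local_at e e' D (j + k) (thicken e j X) (thicken e' j X').
Proof. by move=> loc; elim: j => // j IH; apply: local_at_nbhd. Qed.

Lemma local_at_degree1 k X X' : local_at e e' D k X X' ->
  local_at e e' D k.+1 [set v in X | degree_in e X v == 1]
                       [set v in X' | degree_in e' X' v == 1].
Proof.
move=> loc v /notin_thickenS[vD [rows nbr]].
rewrite !inE loc//; congr (_ && (_ == 1)); apply: eq_card => u; rewrite !inE.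
by rewrite -rows; case: (boolP (e v u)) => [/nbr/loc->|]; rewrite ?andbF.
Qed.

Lemma local_at_card k X X' : local_at e e' D k X X' ->
  #|X| <= #|X'| + #|thicken e k D| /\ #|X'| <= #|X| + #|thicken e k D|.
Proof.
move=> loc.
have cardU (A B : {set T}) : A \subset B :|: thicken e k D ->
    #|A| <= #|B| + #|thicken e k D|.
  by move=> /subset_leq_card/leq_trans; apply; rewrite cardsU leq_subr.
split; apply: cardU; apply/subsetP => v vX; rewrite inE;
  case: (boolP (v \in thicken e k D)) => [_|vD]; rewrite ?orbT ?orbF//.
  by rewrite -(loc _ vD).
by rewrite (loc _ vD).
Qed.

End LocalSets.

(** Like [leaves], but without the convention for one-node graphs, which is not
local. *)
Definition end_nodes (T : finType) (e : rel T) (S : {set T}) :=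
  [set v in S | degree_in e S v == 1].

Fixpoint peel (T : finType) (e : rel T) k : {set T} :=
  if k is k'.+1 then peel e k' :\: end_nodes e (peel e k') else [set: T].

Lemma local_at_peel (T : finType) (e e' : rel T) D k : agree_off e e' D ->
  local_at e e' D k (peel e k) (peel e' k).
Proof.
move=> agr; elim: k => [|k IH] /=; first by move=> v; rewrite !inE.
apply: local_atD; last exact: local_at_degree1.
by apply: local_atW IH.
Qed.

Section Leaves.
Context {T : finType} (e : rel T).
Implicit Types S : {set T}.

Lemma leaves_end_nodes S : #|S| != 1 -> leaves e S = end_nodes e S.
Proof.
move=> S1; apply/setP => v; rewrite !inE; case: eqP => //= _.
by case: (eqVneq S [set v]) S1 => // ->; rewrite cards1.
Qed.

Lemma leaves_singleton S : #|S| = 1 -> leaves e S = S.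
Proof.
move=> /eqP/cards1P[v ->]; apply/setP => u; rewrite !inE.
by case: eqP => // ->; rewrite eqxx orbT.
Qed.

(** Stripping and peeling can only diverge at a one-node graph, which stripping
empties while peeling may keep its node. *)
Lemma iter_strip k : iter k (strip e) [set: T] = peel e k \/
  iter k (strip e) [set: T] = set0 /\ #|peel e k| <= 1.
Proof.
elim: k => [|k [IH|[IH le1]]] /=; [by left| |]; rewrite IH; last first.
  right; split; first by rewrite /strip set0D.
  by apply: leq_trans le1; rewrite subset_leq_card// subsetDl.
have [S1|S1] := eqVneq #|peel e k| 1; last by left; rewrite /strip leaves_end_nodes.
right; split; first by rewrite /strip leaves_singleton// setDv.
by rewrite -S1 subset_leq_card// subsetDl.
Qed.

Lemma num_layer_near k : 
  num_layer e k <= #|end_nodes e (peel e k)| + 1 /\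
  #|end_nodes e (peel e k)| <= num_layer e k + 1.
Proof.
have -> : num_layer e k = #|leaves e (iter k (strip e) [set: T])|.
  by apply: eq_card => v; rewrite inE.
have end_le S : #|end_nodes e S| <= #|S|.
  by rewrite subset_leq_card//; apply/subsetP => v; rewrite inE => /andP[].
have lea_le S : #|leaves e S| <= #|S|.
  by rewrite subset_leq_card//; apply/subsetP => v; rewrite inE => /andP[].
have := end_le (peel e k); have := lea_le (iter k (strip e) [set: T]).
have [->|[-> p1]] := iter_strip k; last by rewrite cards0; lia.
have [->|S1] := eqVneq #|peel e k| 1; first by lia.
by rewrite leaves_end_nodes//; lia.
Qed.

(** The nodes at distance exactly [k] from the end nodes. *)
Definition sphere k : {set T} :=
  if k is k'.+1 then
    thicken e k (end_nodes e [set: T]) :\: thicken e k' (end_nodes e [set: T])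
  else end_nodes e [set: T].

(** The two counts agree except on graphs of at most [k + 1] nodes, where the
one-node convention and the truncation of distances at the number of nodes
interfere; both counts are then at most [k + 1]. *)
Lemma num_rank_near k :
  num_rank e k <= #|sphere k| + k.+1 /\ #|sphere k| <= num_rank e k + k.+1.
Proof.
have [Tk|kT] := leqP #|T| k.+1.
  have : #|sphere k| <= #|T| by apply: max_card.
  have : num_rank e k <= #|T| by apply: max_card.
  lia.
suff -> : num_rank e k = #|sphere k| by lia.
have L : leaves e [set: T] = end_nodes e [set: T].
  by apply: leaves_end_nodes; rewrite cardsT; lia.
apply: eq_card => v; rewrite inE; case: k kT => [|k] kT /=.
  by rewrite -leqn0 rank_leP ?L //; apply: ltnW.
rewrite eqn_leq inE andbC ltnNge !rank_leP ?L //.  all: lia.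
Qed.

End Leaves.

(** The factor [c] also covers bounded corrections, because a nonempty set has a
neighbourhood with at least one element. *)
Definition local_stat (F : forall T : finType, rel T -> nat) K c :=
  forall (T : finType) (e e' : rel T) D, agree_off e e' D -> D != set0 ->
    F T e <= F T e' + c * #|thicken e K D| /\
    F T e' <= F T e + c * #|thicken e K D|.

Lemma local_stat_near (F : forall T : finType, rel T -> nat)
    (X : forall T : finType, rel T -> {set T}) K c :
    (forall T e, F T e <= #|X T e| + c /\ #|X T e| <= F T e + c) ->
    (forall T e e' D, agree_off e e' D -> local_at e e' D K (X T e) (X T e')) ->
  local_stat F K (2 * c + 1).
Proof.
move=> near loc T e e' D agr D0.
have := local_at_card (loc _ _ _ _ agr).
have D1 : 0 < #|thicken e K D|.
  apply: leq_trans (subset_leq_card (thicken_sub e K D)).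
  by rewrite card_gt0.
have := near T e; have := near T e'; nia.
Qed.

Lemma num_rank_local k : local_stat (fun T e => num_rank e k) k.+1 (2 * k.+1 + 1).
Proof.
apply: (local_stat_near (X := fun T e => sphere e k)) => [T e|T e e' D agr].
  exact: num_rank_near.
have ends : local_at e e' D 1 (end_nodes e [set: T]) (end_nodes e' [set: T]).
  by apply: local_at_degree1 => // v; rewrite !inE.
case: k => // k; apply: local_atD.
  by have := local_at_thicken (j := k.+1) agr ends; rewrite addn1.
by apply: local_atW (local_at_thicken (j := k) agr ends); rewrite addn1.
Qed.

Lemma num_layer_local k : local_stat (fun T e => num_layer e k) k.+1 3.
Proof.
apply: (@local_stat_near _ (fun T e => end_nodes e (peel e k)) _ 1)
  => [T e|T e e' D agr].
  exact: num_layer_near.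
by apply: local_at_degree1 => //; apply: local_at_peel.
Qed.

(** * Variance of a local statistic of the random tree *)

Section Tree.
Variables (n : nat) (q : nat -> nat).

Lemma recursive_tree_sym : symmetric (recursive_tree n q).
Proof. by move=> i j; apply: orbC. Qed.

(** Cutting the edge from [i] to its parent only alters adjacencies of [i] and of
this parent, and both belong to the closed neighbourhood of [i]. *)
Lemma agree_off_attach (i : 'I_n) :
  agree_off (recursive_tree n q) (recursive_tree n (attach q i i))
            (nbhd (recursive_tree n q) [set i]).
Proof.
move=> v u /notin_nbhd[]; rewrite inE => vi /(_ i); rewrite inE eqxx => nvi.
have vi' : (v == i :> nat) = false by apply: negbTE.
have {nvi} : ~~ recursive_tree n q v i by apply/negP => /nvi.
rewrite /recursive_tree /attach /= vi'.
have [->|ui] := eqVneq u i; last by rewrite (negbTE (ui : u != i :> nat)).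
rewrite eqxx (eq_sym (i : nat)) vi' andbF negb_or /=.
by move=> /andP[/negbTE-> /negbTE->].
Qed.

(** A node is adjacent to its children and to its parent, and it belongs to its own
closed neighbourhood. *)
Lemma nbhd_size_children (v : 'I_n) :
  nbhd_size (recursive_tree n q) v <= children q n v + 2.
Proof.
pose A := [set u : 'I_n | q v == u].
pose B := [set u : 'I_n | (q u == v) && (v < u)].
have A1 : #|A| <= 1.
  apply/card_le1_eqP => x y; rewrite !inE => /eqP qx /eqP qy.
  by apply: val_inj; rewrite /= -qx.
have BE : #|B| = children q n v.
  rewrite -sum1_card big_mkcond /children.
  rewrite (eq_bigr (fun u : 'I_n => ((q u == v) && (v < u) : nat))) => [|u _].
    case: n v {A B A1} => [|m] v; first by case: v.
    rewrite -(big_mkord predT (fun u => ((q u == v) && (v < u) : nat))).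
    by rewrite [LHS]big_ltn//= andbF.
  by rewrite inE; case: ifP.
have : nbhd (recursive_tree n q) [set v] \subset v |: (A :|: B).
  apply/subsetP => u; rewrite !inE => /orP[->//|/existsP[w]].
  rewrite inE => /andP[/eqP->] /= /orP[/andP[_ ->]|/andP[-> ->]];
  by rewrite ?orbT.
move=> /subset_leq_card/leq_trans; apply.
apply: leq_trans (leq_card_setU _ _) _; rewrite cards1.
have := leq_of_leqif (leq_card_setU A B); rewrite BE; lia.
Qed.
End Tree.

Section TreeVariance.
Local Open Scope ring_scope.
Context {R : realFieldType}.

Definition tree_stat (F : forall T : finType, rel T -> nat) N q : R :=
  (F _ (recursive_tree N.+1 q))%:R.

(** The Efron-Stein inequality, applied with the statistic of the tree in which the
edge from [i] to its parent is cut. *)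
Lemma avg_variance_local_stat F K c : local_stat F K c ->
  exists2 C : R, 0 <= C & forall N,
  avg N (fun q => (tree_stat F N q - avg N (tree_stat F N)) ^+ 2) <= C * N.+1%:R.
Proof.
move=> loc; have [C [p ballC]] := ball_moment_le K.+1 2.
have [|M M0 expM] := @expn_le_exp R (3 / 2) p; first by apply/andP; split; lra.
(* [(3 / 2) ^+ 2] pays for the parent and the node itself, which are in the closed
   neighbourhood of a node but not among its children. *)
pose M' : R := (c ^ 2 * C)%:R * (M * (3 / 2) ^+ 2).
have M'0 : 0 <= M'.
  by rewrite !mulr_ge0 ?ler0n ?exprn_ge0// ?ltW//; lra.
exists (M' * 2) => [|N]; first by rewrite mulr_ge0.
set f := tree_stat F N.
pose b q i := #|ball (recursive_tree N.+1 q) K.+1 (inord i)|.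
have diff q i : (0 < i < N.+1)%N ->
    (f q - f (attach q i i)) ^+ 2 <= (c ^ 2 * b q i ^ 2)%:R.
  move=> /andP[_ iN]; have iE := inordK iN.
  set e := recursive_tree N.+1 q; set e' := recursive_tree N.+1 (attach q i i).
  have agr : agree_off e e' (nbhd e [set inord i]).
    have := @agree_off_attach N.+1 q (inord i).
    by rewrite iE.
  have [] := loc _ e e' _ agr.
    by rewrite -card_gt0; apply: nbhd_size_gt0.
  have -> : thicken e K (nbhd e [set inord i]) = ball e K.+1 (inord i).
    by rewrite /ball /thicken iterSr.
  rewrite -/(b q i) -expnMn natrX /f /tree_stat -/e -/e'.
  rewrite -!(ler_nat R) !natrD => le1 le2.
  have le : `|(F _ e)%:R - (F _ e')%:R| <= (c * b q i)%:R :> R.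
    by rewrite ler_norml; apply/andP; split; lra.
  by rewrite -(real_normK (num_real _)) lerXn2r ?nnegrE.
have sum_le q : \sum_(1 <= i < N.+1) (f q - f (attach q i i)) ^+ 2 <=
    M' * exp_children N.+1 q.
  have step1 : \sum_(1 <= i < N.+1) (f q - f (attach q i i)) ^+ 2 <=
      (\sum_(i < N.+1) c ^ 2 * b q i ^ 2)%:R.
    rewrite natr_sum -(big_mkord predT (fun i => (c ^ 2 * b q i ^ 2)%:R)).
    rewrite [leRHS]big_ltn// -[leLHS]add0r lerD//.
    by apply: ler_sum_nat => i; apply: diff.
  apply: le_trans step1 _; rewrite /M' natrM -mulrA.
  have -> : (\sum_(i < N.+1) c ^ 2 * b q i ^ 2)%N =
      (c ^ 2 * \sum_(v : 'I_N.+1) #|ball (recursive_tree N.+1 q) K.+1 v| ^ 2)%N.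
    by rewrite big_distrr; apply: eq_bigr => i _; rewrite /b inord_val.
  rewrite natrM -mulrA ler_wpM2l//.
  apply: le_trans
    (_ : (C * \sum_v nbhd_size (recursive_tree N.+1 q) v ^ p)%:R <= _).
    by rewrite ler_nat ballC//; apply: recursive_tree_sym.
  rewrite natrM ler_wpM2l// natr_sum /exp_children mulr_sumr ler_sum// => v _.
  apply: le_trans (expM _) _; rewrite -mulrA ler_pM2l// -exprD addnC.
  by rewrite ler_weXn2l ?nbhd_size_children//; lra.
apply: le_trans (_ : \sum_(1 <= i < N.+1)
    avg N (fun q => (f q - f (attach q i i)) ^+ 2) <= _).
  apply: efron_stein => i q q' qq'; congr (f _); apply: boolp.funext => x.
  by rewrite /attach /=; case: (eqVneq x i) => // /qq'.
rewrite -avg_sum; apply: le_trans (ler_avg _ sum_le) _.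
by rewrite avgZ -mulrA ler_wpM2l// avg_exp_children.
Qed.
End TreeVariance.

(** * From iterated averages to an arbitrary probability space *)

From mathcomp Require Import finmap.
From mathcomp Require Import all_classical all_reals all_analysis.
From mathcomp Require Import measurable_realfun.

Section Bridge.
Local Open Scope classical_set_scope.
Local Open Scope ereal_scope.
Context (d : measure_display) (T : measurableType d) (R : realType)
  (P : probability T R) (par : nat -> {RV P >-> nat}) (N : nat).
Hypothesis unif : uniform_attachment N.+1 par.

Let parent w i := par i w.

(** The value at [0], the root, is excluded: the root has no parent. *)
Definition depends_upto m (A : Type) (F : (nat -> nat) -> A) :=
  forall q q', (forall i, (0 < i <= m)%N -> q i = q' i) -> F q = F q'.

Lemma depends_upto_attach m A (F : (nat -> nat) -> A) j :
  depends_upto m.+1 F -> depends_upto m (fun q => F (attach q m.+1 j)).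
Proof.
move=> dep q q' qq'; apply: dep => i /andP[i0 im].
rewrite /attach/=; case: eqVneq => // im'.
by apply: qq'; rewrite i0 -ltnS ltn_neqAle im'.
Qed.

Lemma measurable_parent i (B : set nat) : measurable (par i @^-1` B).
Proof. by rewrite -[X in measurable X]setTI; apply: measurable_funPT. Qed.

(** A preimage is the union, over the countably many values of the parent of the
last node, of preimages under functions of the remaining parents. *)
Lemma measurable_depends m (F : (nat -> nat) -> R) :
  depends_upto m F -> measurable_fun setT (fun w => F (parent w)).
Proof.
elim: m F => [|m IH] F dep.
  rewrite (_ : (fun w => _) = cst (F (fun=> 0%N))); first exact: measurable_cst.
  by apply/funext => w; apply: dep => i; rewrite leqn0 lt0n; case: eqP.
move=> _ Y mY; rewrite setTI.
have -> : (fun w => F (parent w)) @^-1` Y = \bigcup_j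
    (par m.+1 @^-1` [set j] `&` (fun w => F (attach (parent w) m.+1 j)) @^-1` Y).
  have attach_par w : F (attach (parent w) m.+1 (par m.+1 w)) = F (parent w).
    by apply: dep => i _; rewrite /attach/=; case: eqP => // ->.
  apply/seteqP; split=> [w Yw|w [j _ [/= <-]]].
    by exists (par m.+1 w) => //; split=> //=; rewrite attach_par.
  by rewrite attach_par.
apply: bigcupT_measurable => j; apply: measurableI; first exact: measurable_parent.
rewrite -[X in measurable X]setTI.
by apply: (IH _ (@depends_upto_attach m R F j dep) measurableT).
Qed.

(** The values below [i] already carry mass [i * (1 / i) = 1]. *)
Lemma parent_ge_null i : (0 < i <= N)%N -> P (par i @^-1` [set j | (i <= j)%N]) = 0.
Proof.
move=> /andP[i0 iN]; pose F (j : nat) := par i @^-1` [set j].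
have mF j : measurable (F j) by apply: measurable_parent.
have -> : par i @^-1` [set j | (i <= j)%N] = ~` \big[setU/set0]_(j < i) F j.
  rewrite -bigcup_mkord; apply/seteqP; split=> w /=.
    by move=> + [j /= ji]; rewrite /F /= => + wj; rewrite wj leqNgt ji.
  by move=> H; rewrite leqNgt; apply/negP => wi; apply: H; exists (par i w).
rewrite probability_setC; last exact: bigsetU_measurable.
rewrite measure_bigsetU//; last first.
  apply/trivIsetP => j j' _ _ jj'; apply/seteqP; split=> // w [].
  by rewrite /F /= => -> /eqP; rewrite (negbTE jj').
rewrite (eq_bigr (fun=> (i%:R^-1)%R%:E)) => [|j _]; last exact: unif.1.
rewrite sumEFin sumr_const card_ord -[(_ *+ i)%R]mulr_natl divff ?subee//.
by rewrite pnatr_eq0 -lt0n.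
Qed.

(** The nodes whose parents are fixed when the integral over the parents of
[1, ..., m] is computed. *)
Definition tail m : {fset nat} := [fset i in iota m.+1 (N - m)]%fset.

Definition tail_event m (c : nat -> nat) : set T :=
  \bigcap_(i in [set` tail m]) (par i @^-1` [set c i]).

Lemma mem_tail m i : (i \in tail m) = (m < i <= N)%N.
Proof. by rewrite !inE mem_iota; lia. Qed.

Lemma measurable_tail_event m c : measurable (tail_event m c).
Proof.
apply: fin_bigcap_measurable; first exact: finite_fset.
by move=> i _; apply: measurable_parent.
Qed.

Lemma tail_event_attach m c j : (m < N)%N ->
  tail_event m (attach c m.+1 j) = tail_event m.+1 c `&` par m.+1 @^-1` [set j].
Proof.
move=> mN; apply/seteqP; split=> w.
  move=> H; split=> [i /=|].
    rewrite mem_tail => /andP[mi iN].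
    by have := H i; rewrite /attach /= mem_tail iN (ltnW mi) gtn_eqF// => ->.
  by have := H m.+1; rewrite /attach /= mem_tail ltnSn mN eqxx => ->.
move=> [H /= wj] i /=; rewrite /attach /= mem_tail => /andP[mi iN].
case: eqVneq => [->//|im]; apply: H => /=.
by rewrite mem_tail iN andbT ltn_neqAle eq_sym im.
Qed.

(** Independence of the parents of the nodes above [m], and of those above [m + 1],
lets the factor of the node [m + 1] split off. *)
Lemma prob_tail_event_attach m c j : (m < N)%N -> (j <= m)%N ->
  P (tail_event m (attach c m.+1 j)) = (m.+1%:R^-1)%:E * P (tail_event m.+1 c).
Proof.
move=> mN jm; have ind := unif.2.
have tail_sub k : [set` tail k] `<=` [set i | (0 < i < N.+1)%N].
  by move=> i /=; rewrite mem_tail; lia.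
have Etail k b := ind (tail k) (fun i => [set b i]) (tail_sub k) (fun=> I).
rewrite /tail_event !Etail.
have -> : tail m = (m.+1 |` tail m.+1)%fset.
  by apply/fsetP => i; rewrite !inE/= !mem_iota; lia.
rewrite big_fsetU1/=; last by rewrite mem_tail ltnn.
rewrite /attach /= eqxx unif.1//; congr (_ * _).
rewrite big_seq [RHS]big_seq; apply: eq_bigr => i; rewrite mem_tail => /andP[mi _].
by rewrite gtn_eqF.
Qed.

(** Induction on [m]: the event splits according to the parent [j] of [m + 1], up to
the null event that this parent is not one of [0, ..., m]; on each piece [F] may
be replaced with a function that no longer depends on the parent of [m + 1]. *)
Lemma integral_tail_event m (F : (nat -> nat) -> R) c : (m <= N)%N ->
    (forall q, (0 <= F q)%R) -> depends_upto m F ->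
  \int[P]_(w in tail_event m c) (F (parent w))%:E =
  (avg m F)%:E * P (tail_event m c).
Proof.
elim: m F c => [|m IH] F c mN F0 dep.
  rewrite -integral_cst; last exact: measurable_tail_event.
  apply: eq_integral => w _ /=; congr EFin.
  by apply: dep => i; rewrite leqn0 lt0n; case: eqP.
pose D j := tail_event m (attach c m.+1 j).
have mD j : measurable (D j) by apply: measurable_tail_event.
(* the event that the parent of [m + 1] is not an existing node *)
pose Z := tail_event m.+1 c `&` par m.+1 @^-1` [set j | (m.+1 <= j)%N].
have mZ : measurable Z.
  by apply: measurableI; [apply: measurable_tail_event|apply: measurable_parent].
have mF (A : set T) : measurable_fun A (EFin \o (fun w => F (parent w))).
  apply/measurable_EFinP; apply: measurable_funTS; exact: measurable_depends dep.
have splitD : tail_event m.+1 c = \big[setU/set0]_(j <- index_iota 0 m.+1) D j `|` Z.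
  rewrite big_mkord -bigcup_mkord; apply/seteqP; split=> w.
    move=> cw; case: (ltnP (par m.+1 w) m.+1) => H; [left|by right].
    by exists (par m.+1 w) => //; rewrite /D tail_event_attach.
  by case=> [[j _]|[]//]; rewrite /D tail_event_attach// => -[].
have DE j w : D j w -> par m.+1 w = j by rewrite /D tail_event_attach// => -[].
rewrite [in LHS]splitD ge0_integral_setU//; last 3 first.
- exact: bigsetU_measurable.
- by move=> w _; rewrite lee_fin.
- rewrite disj_set2E big_mkord -bigcup_mkord; apply/eqP/seteqP; split=> // w.
  move=> [[j /= jm /DE wj] [_ /=]].
  by rewrite wj leqNgt jm.
rewrite [X in _ + X]null_set_integral ?adde0//; last first.
  apply/eqP; rewrite eq_le measure_ge0 andbT -(@parent_ge_null m.+1)//.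
  by apply: le_measure; rewrite ?inE//; [apply: measurable_parent|move=> w []].
rewrite ge0_integral_bigsetU//; last 3 first.
- exact: iota_uniq.
- apply/trivIsetP => j j' _ _ jj'; apply/seteqP; split=> // w [/DE wj /DE wj'].
  by move: jj'; rewrite -wj -wj' eqxx.
- by move=> w _; rewrite lee_fin.
rewrite big_mkord.
have -> : avg m.+1 F =
    (m.+1%:R^-1 * \sum_(j < m.+1) avg m (fun q => F (attach q m.+1 j)))%R.
  by rewrite /= /attach_mean /mean avgZ avg_sum.
rewrite (eq_bigr (fun j : 'I_m.+1 => (avg m (fun q => F (attach q m.+1 j)))%:E *
   ((m.+1%:R^-1)%:E * P (tail_event m.+1 c)))) => [|j _].
  have /fineK <- : P (tail_event m.+1 c) \is a fin_num.
    by apply: fin_num_measure; apply: measurable_tail_event.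
  under eq_bigr do rewrite -!EFinM.
  by rewrite sumEFin -mulr_suml -EFinM mulrCA mulrA.
rewrite -(@prob_tail_event_attach m c j)//; last by rewrite -ltnS.
rewrite -IH//; [|exact: ltnW|exact: depends_upto_attach].
apply: eq_integral => w; rewrite inE => /DE wj; congr EFin; apply: dep => i _.
by rewrite /attach/=; case: eqP => // ->.
Qed.

Lemma integral_avg (F : (nat -> nat) -> R) :
    (forall q, (0 <= F q)%R) -> depends_upto N F ->
  \int[P]_w (F (parent w))%:E = (avg N F)%:E.
Proof.
move=> F0 dep; have tailT : tail_event N (fun=> 0%N) = setT.
  by apply/seteqP; split=> // w _ i /=; rewrite mem_tail; lia.
by rewrite -tailT integral_tail_event// tailT probability_setT mule1.
Qed.

Lemma variance_avg (F : (nat -> nat) -> R) :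
    (forall q, (0 <= F q)%R) -> depends_upto N F ->
  'V_P[fun w => F (parent w)] = (avg N (fun q => (F q - avg N F) ^+ 2)%R)%:E.
Proof.
move=> F0 dep.
have mean_eq : 'E_P[fun w => F (parent w)] = (avg N F)%:E.
  by rewrite unlock integral_avg.
rewrite /variance unlock mean_eq unlock -(@integral_avg (fun q => (F q - avg N F) ^+ 2)%R).
- by apply: eq_integral => w _; rewrite expr2.
- by move=> q; apply: sqr_ge0.
- by move=> q q' qq'; rewrite (dep q q').
Qed.

Lemma variance_tree_stat (F : forall T : finType, rel T -> nat) C :
    (avg N (fun q => (tree_stat F N q - avg N (tree_stat F N)) ^+ 2)
       <= C * N.+1%:R)%R ->
  ('V_P[fun w => ((F _ (recursive_tree N.+1 (fun i => par i w)))%:R / N.+1%:R)%R]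
    <= (C / N.+1%:R)%:E)%E.
Proof.
move=> le_C; pose f (q : nat -> nat) : R := (N.+1%:R^-1 * tree_stat F N q)%R.
have -> : (fun w =>
      ((F _ (recursive_tree N.+1 (fun i => par i w)))%:R / N.+1%:R)%R) =
    (fun w => f (parent w)) by apply/funext => w; rewrite /f mulrC.
rewrite variance_avg; last 2 first.
- by move=> q; rewrite mulr_ge0// invr_ge0.
- move=> q q' qq'; congr (_ * (F _ _)%:R)%R; apply/funext => i; apply/funext => j.
  rewrite /recursive_tree /=.
  congr orb; have [|//] := ltnP; rewrite ?andFb// => ij.
    by rewrite qq'// (leq_ltn_trans _ ij)//= -ltnS.
  by rewrite qq'// (leq_ltn_trans _ ij)//= -ltnS.
rewrite lee_fin.
have -> : avg N (fun q => (f q - avg N f) ^+ 2)%R =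
  (N.+1%:R^-2 * avg N (fun q => (tree_stat F N q - avg N (tree_stat F N)) ^+ 2))%R.
  by rewrite -avgZ; apply: eq_avg => q; rewrite avgZ -mulrBr exprMn exprVn.
apply: le_trans (ler_wpM2l _ le_C) _; first by rewrite invr_ge0 exprn_ge0.
by rewrite mulrC expr2 invfM mulrA mulfK ?pnatr_eq0.
Qed.

End Bridge.

Local Open Scope ring_scope.

Theorem theorem5 (R : realType) (k : nat) :
  exists C : R,
    forall (n : nat) (d : measure_display) (T : measurableType d)
      (P : probability T R) (par : nat -> {RV P >-> nat}),
      (0 < n)%N -> uniform_attachment n par ->
      ('V_P[fun w => ((num_rank (recursive_tree n (fun i => par i w)) k)%:R
                     / n%:R)%R] <= (C / n%:R)%:E)%E /\
      ('V_P[fun w => ((num_layer (recursive_tree n (fun i => par i w)) k)%:R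
                     / n%:R)%R] <= (C / n%:R)%:E)%E.
Proof.
have [C1 C1_ge0 rank_le] := avg_variance_local_stat (R := R) (num_rank_local k).
have [C2 C2_ge0 layer_le] := avg_variance_local_stat (R := R) (num_layer_local k).
exists (C1 + C2) => -[//|N] d T P par _ unif; split.
- apply: (variance_tree_stat (F := fun T e => num_rank e k) unif).
  apply: le_trans (rank_le N) _.
  by rewrite ler_wpM2r// lerDl.
- apply: (variance_tree_stat (F := fun T e => num_layer e k) unif).
  apply: le_trans (layer_le N) _.
  by rewrite ler_wpM2r// lerDr.
Qed.
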